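(* Let $k$ be a field, let $\mathcal{C}$ be a skeletally small Hom-finite Krull-Schmidt triangulated category over $k$ with suspension functor $\Sigma$, and let $T$ be a rigid object of $\mathcal{C}$. Let $\widetilde{\mathcal{S}}$ be the class of maps $f\colon X\to Y$ in $\mathcal{C}$ such that, when $f$ is completed to a triangle $\Sigma^{-1}Z\overset{h}{\to}X\overset{f}{\to}Y\overset{g}{\to}Z$, both $g$ and $h$ factor through objects of $\mathcal{X}_T=\{X\in\mathcal{C}\mid \operatorname{Hom}_{\mathcal{C}}(T,X)=0\}$. Let $L_{\widetilde{\mathcal{S}}}\colon\mathcal{C}\to\mathcal{C}_{\widetilde{\mathcal{S}}}$ be the Gabriel-Zisman localisation of $\mathcal{C}$ at $\widetilde{\mathcal{S}}$, and let $G\colon\mathcal{C}_{\widetilde{\mathcal{S}}}\to\operatorname{mod}\operatorname{End}_{\mathcal{C}}(T)^{op}$ be the unique functor such that $G L_{\widetilde{\mathcal{S}}}=\operatorname{Hom}_{\mathcal{C}}(T,-)$. Then $G$ is an equivalence of categories.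
   Context: $\operatorname{Ext}^1_{\mathcal{C}}(A,B)$ means $\operatorname{Hom}_{\mathcal{C}}(A,\Sigma B)$; an object $T$ is rigid if $\operatorname{Ext}^1_{\mathcal{C}}(T,T)=0$. $\operatorname{mod}\operatorname{End}_{\mathcal{C}}(T)^{op}$ is the category of finite-dimensional (left) $\operatorname{End}_{\mathcal{C}}(T)^{op}$-modules; $\operatorname{Hom}_{\mathcal{C}}(T,X)$ is such a module via precomposition. The class $\widetilde{\mathcal{S}}$ does not depend on the choice of completion of $f$ to a triangle. The Gabriel-Zisman localisation $L_{\mathcal{M}}\colon\mathcal{C}\to\mathcal{C}_{\mathcal{M}}$ at a class of maps $\mathcal{M}$ is obtained by formally inverting the maps in $\mathcal{M}$: $\mathcal{C}_{\mathcal{M}}$ has the same objects as $\mathcal{C}$, $L_{\mathcal{M}}$ is the identity on objects and inverts all maps in $\mathcal{M}$, and every functor from $\mathcal{C}$ which inverts the maps in $\mathcal{M}$ factors uniquely through $L_{\mathcal{M}}$. No calculus of fractions is assumed. The functor $\operatorname{Hom}_{\mathcal{C}}(T,-)\colon\mathcal{C}\to\operatorname{mod}\operatorname{End}_{\mathcal{C}}(T)^{op}$ inverts all maps in $\widetilde{\mathcal{S}}$, so $G$ exists and is unique. *)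

(* Defs.v *)
From HB Require Import structures.
From mathcomp Require Import all_boot all_algebra.
From mathcomp Require Import boolp.

Set Implicit Arguments.
Unset Strict Implicit.
Unset Printing Implicit Defensive.

Import GRing.Theory.
Local Open Scope ring_scope.

Declare Scope cat_scope.
Delimit Scope cat_scope with cat.

(* The category structure is separated from the collection of objects so that
   one can speak of several categories with literally the same objects (a
   category and its localisation). *)
Record cat_struct (O : Type) := CatStruct {
  cs_hom : O -> O -> Type;
  cs_id : forall X, cs_hom X X;
  cs_comp : forall X Y Z, cs_hom Y Z -> cs_hom X Y -> cs_hom X Z;
  cs_compA : forall W X Y Z
      (h : cs_hom Y Z) (g : cs_hom X Y) (f : cs_hom W X),
    cs_comp h (cs_comp g f) = cs_comp (cs_comp h g) f;
  cs_comp1m : forall X Y (f : cs_hom X Y), cs_comp (cs_id Y) f = f;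
  cs_compm1 : forall X Y (f : cs_hom X Y), cs_comp f (cs_id X) = f
}.

Record category := Category {
  obj :> Type;
  obj_struct : cat_struct obj
}.

Definition mor (C : category) : C -> C -> Type := cs_hom (obj_struct C).
Definition idmor (C : category) (X : C) : mor X X := cs_id (obj_struct C) X.
Definition compm (C : category) (X Y Z : C) :
  mor Y Z -> mor X Y -> mor X Z := @cs_comp _ (obj_struct C) X Y Z.

Notation "g \o f" := (compm g f) : cat_scope.
Local Open Scope cat_scope.

Section CategoryTheory.
Variable C : category.

Lemma compmA (W X Y Z : C) (h : mor Y Z) (g : mor X Y) (f : mor W X) :
  h \o (g \o f) = (h \o g) \o f.
Proof. exact: cs_compA. Qed.

Lemma comp1m (X Y : C) (f : mor X Y) : idmor Y \o f = f.
Proof. exact: cs_comp1m. Qed.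

Lemma compm1 (X Y : C) (f : mor X Y) : f \o idmor X = f.
Proof. exact: cs_compm1. Qed.

Definition is_iso (X Y : C) (f : mor X Y) : Prop :=
  exists g : mor Y X, g \o f = idmor X /\ f \o g = idmor Y.

Definition isomorphic (X Y : C) : Prop := exists f : mor X Y, is_iso f.

(* [choiceType] plays the role of the sets: all Hom-spaces below are carried by
   choice types, whereas the universe of [obj C] is not bounded by theirs. *)
Definition skeletally_small : Prop :=
  exists (I : choiceType) (F : I -> C), forall X, exists i, isomorphic X (F i).

End CategoryTheory.

Record functor (C D : category) := Functor {
  fobj :> C -> D;
  fmap : forall X Y, mor X Y -> mor (fobj X) (fobj Y);
  fmap1 : forall X, fmap (idmor X) = idmor (fobj X);
  fmap_comp : forall X Y Z (g : mor Y Z) (f : mor X Y),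
    fmap (g \o f) = fmap g \o fmap f
}.

Definition idF (C : category) : functor C C :=
  @Functor C C id (fun _ _ f => f) (fun _ => erefl) (fun _ _ _ _ _ => erefl).

Section FunctorComposition.
Variables (C D E : category) (G : functor D E) (F : functor C D).

Lemma compF_fmap1 (X : C) : fmap G (fmap F (idmor X)) = idmor (G (F X)).
Proof. by rewrite !fmap1. Qed.

Lemma compF_fmap_comp (X Y Z : C) (g : mor Y Z) (f : mor X Y) :
  fmap G (fmap F (g \o f)) = fmap G (fmap F g) \o fmap G (fmap F f).
Proof. by rewrite !fmap_comp. Qed.

Definition compF : functor C E :=
  @Functor C E (fun X => G (F X)) (fun _ _ f => fmap G (fmap F f))
    compF_fmap1 compF_fmap_comp.

End FunctorComposition.

Record nat_iso (C D : category) (F G : functor C D) := NatIso {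
  ni_hom : forall X, mor (F X) (G X);
  ni_inv : forall X, mor (G X) (F X);
  ni_homK : forall X, ni_inv X \o ni_hom X = idmor (F X);
  ni_invK : forall X, ni_hom X \o ni_inv X = idmor (G X);
  ni_natural : forall X Y (f : mor X Y),
    ni_hom Y \o fmap F f = fmap G f \o ni_hom X
}.

Definition is_equivalence (C D : category) (F : functor C D) : Prop :=
  exists G : functor D C,
    inhabited (nat_iso (compF G F) (idF C)) /\
    inhabited (nat_iso (compF F G) (idF D)).

Definition map_class (C : category) := forall X Y : C, mor X Y -> Prop.

Definition inverts (C D : category) (M : map_class C) (F : functor C D) : Prop :=
  forall (X Y : C) (f : mor X Y), M X Y f -> is_iso (fmap F f).

(* Factorisations are strict: [=] is equality of functors, not natural
   isomorphism. *)
Definition is_localisation (C : category) (M : map_class C)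
    (CM : cat_struct C) (L : functor C (Category CM)) : Prop :=
  [/\ forall X : C, L X = X,
      inverts M L
    & forall (D : category) (F : functor C D), inverts M F ->
        exists! F' : functor (Category CM) D, compF F' L = F].

Definition finite_dimensional (k : fieldType) (V : lmodType k) : Prop :=
  exists n, inhabited (Vector.axiom n V).

Record linear_category (k : fieldType) := LinearCategory {
  lin_obj : Type;
  lin_hom : lin_obj -> lin_obj -> lmodType k;
  lin_id : forall X, lin_hom X X;
  lin_comp : forall X Y Z, lin_hom Y Z -> lin_hom X Y -> lin_hom X Z;
  lin_compA : forall W X Y Z
      (h : lin_hom Y Z) (g : lin_hom X Y) (f : lin_hom W X),
    lin_comp h (lin_comp g f) = lin_comp (lin_comp h g) f;
  lin_comp1m : forall X Y (f : lin_hom X Y), lin_comp (lin_id Y) f = f;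
  lin_compm1 : forall X Y (f : lin_hom X Y), lin_comp f (lin_id X) = f;
  lin_comp_linearl : forall X Y Z (f : lin_hom X Y),
    linear (fun g : lin_hom Y Z => lin_comp g f);
  lin_comp_linearr : forall X Y Z (g : lin_hom Y Z),
    linear (fun f : lin_hom X Y => lin_comp g f)
}.

Definition cat_of_linear (k : fieldType) (C : linear_category k) : category :=
  Category (CatStruct (@lin_compA k C) (@lin_comp1m k C) (@lin_compm1 k C)).
Coercion cat_of_linear : linear_category >-> category.

Section LinearCategoryTheory.
Variables (k : fieldType) (C : linear_category k).

Lemma comp_linearl (X Y Z : C) (f : mor X Y) :
  linear (fun g : mor Y Z => g \o f).
Proof. exact: lin_comp_linearl. Qed.

Lemma comp_linearr (X Y Z : C) (g : mor Y Z) :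
  linear (fun f : mor X Y => g \o f).
Proof. exact: lin_comp_linearr. Qed.

Definition hom_finite : Prop :=
  forall X Y : C, finite_dimensional (mor X Y).

Definition is_zero_object (Z : C) : Prop :=
  (forall X (f : mor X Z), f = 0) /\ (forall X (f : mor Z X), f = 0).

Definition is_direct_sum (n : nat) (F : 'I_n -> C) (S : C) : Prop :=
  exists (inj : forall i, mor (F i) S) (prj : forall i, mor S (F i)),
    [/\ forall i, prj i \o inj i = idmor (F i),
        forall i j, i != j -> prj j \o inj i = 0
      & \sum_i (inj i \o prj i) = idmor S].

(* For n = 0 this provides a zero object. *)
Definition additive_category : Prop :=
  forall (n : nat) (F : 'I_n -> C), exists S : C, is_direct_sum F S.

(* The units of End(X) are the automorphisms of X; a ring is local when it is
   nonzero and the sum of two non-units is a non-unit. *)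
Definition has_local_endomorphism_ring (X : C) : Prop :=
  idmor X <> 0 /\
  forall a b : mor X X, ~ is_iso a -> ~ is_iso b -> ~ is_iso (a + b : mor X X).

Definition krull_schmidt : Prop :=
  forall X : C, exists (n : nat) (F : 'I_n -> C),
    (forall i, has_local_endomorphism_ring (F i)) /\ is_direct_sum F X.

End LinearCategoryTheory.

Section Triangulation.
Variables (k : fieldType) (C : linear_category k) (S : functor C C).
Variable dist :
  forall X Y Z : C, mor X Y -> mor Y Z -> mor Z (S X) -> Prop.

Record triangulation_axioms : Prop := TriangulationAxioms {
  tr1_iso : forall (X Y Z X' Y' Z' : C)
      (u : mor X Y) (v : mor Y Z) (w : mor Z (S X))
      (u' : mor X' Y') (v' : mor Y' Z') (w' : mor Z' (S X'))
      (f : mor X X') (g : mor Y Y') (h : mor Z Z'),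
    dist u v w -> is_iso f -> is_iso g -> is_iso h ->
    g \o u = u' \o f -> h \o v = v' \o g -> fmap S f \o w = w' \o h ->
    dist u' v' w';
  tr1_id : forall X Z : C, is_zero_object Z ->
    dist (idmor X) (0 : mor X Z) (0 : mor Z (S X));
  tr1_cone : forall (X Y : C) (u : mor X Y),
    exists (Z : C) (v : mor Y Z) (w : mor Z (S X)), dist u v w;
  tr2 : forall (X Y Z : C) (u : mor X Y) (v : mor Y Z) (w : mor Z (S X)),
    dist u v w <-> dist v w (- fmap S u);
  tr3 : forall (X Y Z X' Y' Z' : C)
      (u : mor X Y) (v : mor Y Z) (w : mor Z (S X))
      (u' : mor X' Y') (v' : mor Y' Z') (w' : mor Z' (S X'))
      (f : mor X X') (g : mor Y Y'),
    dist u v w -> dist u' v' w' -> g \o u = u' \o f ->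
    exists h : mor Z Z', h \o v = v' \o g /\ fmap S f \o w = w' \o h;
  tr4 : forall (X Y Z X' Y' Z' : C)
      (u : mor X Y) (u1 : mor Y Z') (u2 : mor Z' (S X))
      (v : mor Y Z) (v1 : mor Z X') (v2 : mor X' (S Y))
      (w1 : mor Z Y') (w2 : mor Y' (S X)),
    dist u u1 u2 -> dist v v1 v2 -> dist (v \o u) w1 w2 ->
    exists (p : mor Z' Y') (q : mor Y' X'),
      [/\ dist p q (fmap S u1 \o v2),
          p \o u1 = w1 \o v, w2 \o p = u2,
          q \o w1 = v1 & v2 \o q = fmap S u \o w2]
}.

End Triangulation.

(* The suspension is an autoequivalence with a chosen quasi-inverse [desusp];
   the case of an automorphism of categories is the one where both natural
   isomorphisms are identities. *)
Record triangulated_category (k : fieldType) := TriangulatedCategory {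
  tri_lin :> linear_category k;
  tri_additive : additive_category tri_lin;
  susp : functor tri_lin tri_lin;
  susp_linear : forall X Y : tri_lin, linear (@fmap _ _ susp X Y);
  desusp : functor tri_lin tri_lin;
  suspK : nat_iso (compF desusp susp) (idF tri_lin);
  desuspK : nat_iso (compF susp desusp) (idF tri_lin);
  dist : forall X Y Z : tri_lin,
    mor X Y -> mor Y Z -> mor Z (susp X) -> Prop;
  tri_axioms : triangulation_axioms dist
}.

Section Rigid.
Variables (k : fieldType) (C : triangulated_category k).

(* The condition Ext^1(A, B) = 0, where Ext^1(A, B) = Hom(A, Sigma B). *)
Definition ext1_vanishes (A B : C) : Prop :=
  forall f : mor A (susp C B), f = 0.

Definition rigid (T : C) : Prop := ext1_vanishes T T.

(* X belongs to X_T. *)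
Definition hom_orthogonal (T X : C) : Prop := forall f : mor T X, f = 0.

Definition factors_through (P : C -> Prop) (X Y : C) (f : mor X Y) : Prop :=
  exists U : C, P U /\ exists (a : mor X U) (b : mor U Y), f = b \o a.

(* h, f, g form a triangle  desusp Z -> X -> Y -> Z : the third map of a
   distinguished triangle starting at [desusp Z] ends at [susp (desusp Z)],
   which is identified with Z by [desuspK]. *)
Definition dist_desusp (X Y Z : C)
    (h : mor (desusp C Z) X) (f : mor X Y) (g : mor Y Z) : Prop :=
  dist h f (ni_inv (desuspK C) Z \o g).

Definition S_tilde (T : C) : map_class C := fun X Y f =>
  exists (Z : C) (h : mor (desusp C Z) X) (g : mor Y Z),
    [/\ dist_desusp h f g,
        factors_through (hom_orthogonal T) g
      & factors_through (hom_orthogonal T) h].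

End Rigid.

Section FinDimModules.
Variables (k : fieldType) (A : pzRingType) (iota : {rmorphism k -> A}).

(* The underlying k-vector space of an A-module. *)
Definition restriction (f : {rmorphism k -> A}) (M : lmodType A) : Type := M.

Section Restriction.
Variable M : lmodType A.
Let V := restriction iota M.
HB.instance Definition _ := GRing.Zmodule.copy V M.
Let scale (c : k) (v : V) : V := (iota c *: (v : M)).

Lemma restriction_scaleA a b v : scale a (scale b v) = scale (a * b) v.
Proof. by rewrite /scale scalerA rmorphM. Qed.
Lemma restriction_scale1 : left_id 1 scale.
Proof. by move=> v; rewrite /scale rmorph1 scale1r. Qed.
Lemma restriction_scaleDr : right_distributive scale +%R.
Proof. by move=> a u v; rewrite /scale scalerDr. Qed.
Lemma restriction_scaleDl v : {morph scale^~ v : a b / a + b}.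
Proof. by move=> a b; rewrite /scale rmorphD scalerDl. Qed.

HB.instance Definition _ := GRing.Zmodule_isLmodule.Build k V
  restriction_scaleA restriction_scale1 restriction_scaleDr
  restriction_scaleDl.
End Restriction.

Record fd_module := FdModule {
  fd_sort :> lmodType A;
  fd_finite : finite_dimensional (restriction iota fd_sort)
}.

Lemma eq_linear (M N : lmodType A) (f g : {linear M -> N}) :
  f =1 g -> f = g.
Proof.
case: f g => [f [[cf0] [cf1]]] [g [[cg0] [cg1]]] /= fg.
have eq_fg : f = g by apply: funext.
case: _ / eq_fg cg0 cg1 fg => cg0 cg1 _.
by rewrite (Prop_irrelevance cf0 cg0) (Prop_irrelevance cf1 cg1).
Qed.

Definition fdmod_id (M : fd_module) : {linear M -> M} := idfun.
Definition fdmod_comp (M N P : fd_module)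
  (g : {linear N -> P}) (f : {linear M -> N}) : {linear M -> P} :=
  (g \o f)%FUN.

Lemma fdmod_compA (M N P Q : fd_module) (h : {linear P -> Q})
    (g : {linear N -> P}) (f : {linear M -> N}) :
  fdmod_comp h (fdmod_comp g f) = fdmod_comp (fdmod_comp h g) f.
Proof. exact: eq_linear. Qed.
Lemma fdmod_comp1m (M N : fd_module) (f : {linear M -> N}) :
  fdmod_comp (fdmod_id N) f = f.
Proof. exact: eq_linear. Qed.
Lemma fdmod_compm1 (M N : fd_module) (f : {linear M -> N}) :
  fdmod_comp f (fdmod_id M) = f.
Proof. exact: eq_linear. Qed.

Definition fdmod : category :=
  Category (CatStruct fdmod_compA fdmod_comp1m fdmod_compm1).

End FinDimModules.

Section EndomorphismRing.
Variables (k : fieldType) (C : linear_category k) (T : C).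

(* Multiplication is composition of endomorphisms, so that the opposite ring is
   [(End_ring T)^c]. It is only a [pzRingType] because T may be a zero object. *)
Definition End_ring : Type := @lin_hom k C T T.
HB.instance Definition _ := GRing.Lmodule.copy End_ring (@lin_hom k C T T).

Let mul (g f : End_ring) : End_ring := (g : mor T T) \o (f : mor T T).

Lemma End_mulA : associative mul.
Proof. exact: (@compmA C T T T T). Qed.
Lemma End_mul1 : left_id (idmor T : End_ring) mul.
Proof. exact: (@comp1m C T T). Qed.
Lemma End_mulr1 : right_id (idmor T : End_ring) mul.
Proof. exact: (@compm1 C T T). Qed.
Lemma End_mulDl : left_distributive mul +%R.
Proof.
by move=> g h f; have := comp_linearl f 1 g h; rewrite !scale1r.
Qed.
Lemma End_mulDr : right_distributive mul +%R.
Proof.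
by move=> f g h; have := comp_linearr f 1 g h; rewrite !scale1r.
Qed.

HB.instance Definition _ := GRing.Zmodule_isPzRing.Build End_ring
  End_mulA End_mul1 End_mulr1 End_mulDl End_mulDr.

Definition End_scalar (c : k) : End_ring^c := (c *: idmor T : End_ring).

Lemma End_scalar_zmod : zmod_morphism End_scalar.
Proof. by move=> a b; apply: scalerBl. Qed.

Lemma End_scalar_monoid : monoid_morphism End_scalar.
Proof.
split=> [|a b]; first exact: scale1r.
have scalable := scalable_linear (comp_linearl (End_scalar a : mor T T)).
rewrite [RHS](_ : _ = b *: (idmor T \o (a *: idmor T))); last exact: scalable.
by rewrite comp1m scalerA mulrC.
Qed.

HB.instance Definition _ :=
  GRing.isZmodMorphism.Build k (End_ring^c) End_scalar End_scalar_zmod.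
HB.instance Definition _ :=
  GRing.isMonoidMorphism.Build k (End_ring^c) End_scalar End_scalar_monoid.

(* The category mod End(T)^op. *)
Definition mod_End_op : category := fdmod End_scalar.

Section HomModule.
Variable X : C.

(* Hom(T, X), on which End(T)^op acts on the left by precomposition. *)
Definition Hom_module : Type := @lin_hom k C T X.
HB.instance Definition _ := GRing.Zmodule.copy Hom_module (@lin_hom k C T X).

Let act (a : End_ring^c) (f : Hom_module) : Hom_module :=
  (f : mor T X) \o (a : mor T T).

Lemma Hom_actA a b f : act a (act b f) = act (a * b) f.
Proof. by rewrite /act -compmA. Qed.
Lemma Hom_act1 : left_id 1 act.
Proof. exact: (@compm1 C T X). Qed.
Lemma Hom_actDr : right_distributive act +%R.
Proof.
by move=> a f g; have := comp_linearl (a : mor T T) 1 f g; rewrite !scale1r.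
Qed.
Lemma Hom_actDl f : {morph act^~ f : a b / a + b}.
Proof.
by move=> a b; have := comp_linearr f 1 (a : mor T T) b; rewrite !scale1r.
Qed.

HB.instance Definition _ := GRing.Zmodule_isLmodule.Build (End_ring^c) Hom_module
  Hom_actA Hom_act1 Hom_actDr Hom_actDl.

End HomModule.

Lemma Hom_module_finite (X : C) : finite_dimensional (mor T X) ->
  finite_dimensional (restriction End_scalar (Hom_module X)).
Proof.
case=> n [[v2r v2r_lin v2r_bij]]; exists n; constructor.
exists v2r => // c f g.
have scaleE : (f : mor T X) \o (c *: idmor T : mor T T) = c *: (f : mor T X).
  have /(_ c (idmor T)) /= -> :=
    scalable_linear (@comp_linearr k C T T X (f : mor T X)).
  exact: (congr1 (fun h => c *: h) (@compm1 C T X f)).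
by rewrite -v2r_lin -scaleE.
Qed.

Section PostComposition.
Variables (X Y : C) (g : mor X Y).

Definition Hom_map (f : Hom_module X) : Hom_module Y := g \o (f : mor T X).

Lemma Hom_map_linear : linear Hom_map.
Proof.
move=> a f f'; have := comp_linearr g 1 ((f : mor T X) \o (a : mor T T)) f'.
by rewrite !scale1r compmA.
Qed.

HB.instance Definition _ :=
  GRing.isLinear.Build (End_ring^c) (Hom_module X) (Hom_module Y) _
    Hom_map Hom_map_linear.

End PostComposition.

Variable hfin : hom_finite C.

Definition HomT_obj (X : C) : mod_End_op :=
  FdModule (Hom_module_finite (hfin T X)).
Definition HomT_map (X Y : C) (g : mor X Y) : mor (HomT_obj X) (HomT_obj Y) :=
  (Hom_map g : {linear Hom_module X -> Hom_module Y}).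

Lemma HomT_map1 (X : C) : HomT_map (idmor X) = idmor (HomT_obj X).
Proof. by apply: eq_linear => f; apply: (@comp1m C T X f). Qed.

Lemma HomT_map_comp (X Y Z : C) (g : mor Y Z) (f : mor X Y) :
  HomT_map (g \o f) = HomT_map g \o HomT_map f.
Proof. by apply: eq_linear => u; rewrite /= /Hom_map -compmA. Qed.

Definition HomT : functor C mod_End_op := Functor HomT_map1 HomT_map_comp.

End EndomorphismRing.

(* Main.v *)
From HB Require Import structures.
Require Import Defs.
From mathcomp Require Import all_boot all_algebra.
From mathcomp Require Import boolp.

Set Implicit Arguments.
Unset Strict Implicit.
Unset Printing Implicit Defensive.

(* Write H = Hom(T, -).  Approximating X by a power of T shows that a map f out
   of X factors through X_T exactly when H f = 0, so S~ consists precisely of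
   the maps inverted by H.  A finite-dimensional module has a presentation by
   powers of T, and the cone P of a map realising it satisfies: H P is the
   given module and every map H P -> H Y is H of some P -> Y.  Hence every X
   receives a map in S~ from such a P.  By induction on the morphisms of the
   localisation, every morphism out of P there is L of a morphism of C; as L f
   depends only on H f, the functor G is fully faithful. *)

Import GRing.Theory.
Local Open Scope ring_scope.
Local Open Scope cat_scope.

(** * Strict equality of functors *)

Lemma functor_congr (C D : category) (o : C -> D)
    (m : forall X Y, mor X Y -> mor (o X) (o Y)) i i' c c' :
  @Functor C D o m i c = @Functor C D o m i' c'.
Proof. by rewrite (Prop_irrelevance i i') (Prop_irrelevance c c'). Qed.

Lemma compF_assoc (B C D E : category) (H : functor D E) (G : functor C D)
    (F : functor B C) : compF H (compF G F) = compF (compF H G) F.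
Proof. exact: functor_congr. Qed.

Lemma compF_idl (C D : category) (F : functor C D) : compF (idF D) F = F.
Proof. by case: F => o m i c; apply: functor_congr. Qed.

(** * Wide subcategories and induction on the morphisms of a localisation *)

Section WideSubcategory.
Variables (C : category) (P : map_class C).
Hypothesis P1 : forall X, P (idmor X).
Hypothesis PM : forall X Y Z (g : mor Y Z) (f : mor X Y),
  P g -> P f -> P (g \o f).

Let hom (X Y : C) := {f : mor X Y | P f}.
Let comp X Y Z (g : hom Y Z) (f : hom X Y) : hom X Z :=
  exist (@P X Z) _ (PM (proj2_sig g) (proj2_sig f)).

Lemma wide_hom_eq (X Y : C) (f g : hom X Y) :
  proj1_sig f = proj1_sig g -> f = g.
Proof.
case: f g => [f pf] [g pg] /= fg; case: _ / fg in pg *.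
by rewrite (Prop_irrelevance pf pg).
Qed.

Lemma wide_compA W X Y Z (h : hom Y Z) (g : hom X Y) (f : hom W X) :
  comp h (comp g f) = comp (comp h g) f.
Proof. by apply: wide_hom_eq; rewrite /= compmA. Qed.

Lemma wide_comp1m X Y (f : hom X Y) : comp (exist _ _ (P1 Y)) f = f.
Proof. by apply: wide_hom_eq; rewrite /= comp1m. Qed.

Lemma wide_compm1 X Y (f : hom X Y) : comp f (exist _ _ (P1 X)) = f.
Proof. by apply: wide_hom_eq; rewrite /= compm1. Qed.

Definition wide_subcategory : category :=
  Category (CatStruct wide_compA wide_comp1m wide_compm1).

Definition wide_inclusion : functor wide_subcategory C :=
  @Functor wide_subcategory C id (fun X Y f => proj1_sig f)
    (fun _ => erefl) (fun _ _ _ _ _ => erefl).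

(** The subcategory has literally the objects of [C], so the lift can keep the object map of [F].
    The composite with the inclusion then differs from [F] only in the proofs of the functor laws,
    and the equality is strict, as the universal property of a localisation demands. *)
Lemma wide_corestriction (B : category) (F : functor B C) :
    (forall X Y (f : mor X Y), P (fmap F f)) ->
  exists F' : functor B wide_subcategory, compF wide_inclusion F' = F.
Proof.
case: F => o m i c /= Pm.
have i' X : exist (@P _ _) _ (Pm X X (idmor X)) =
    @idmor wide_subcategory (o X) by apply: wide_hom_eq; apply: i.
have c' X Y Z (g : mor Y Z) (f : mor X Y) : exist (@P _ _) _ (Pm _ _ (g \o f)) =
    @compm wide_subcategory (o X) (o Y) (o Z)
     (exist _ _ (Pm _ _ g)) (exist _ _ (Pm _ _ f)).
  by apply: wide_hom_eq; apply: c.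
exists (@Functor B wide_subcategory o
  (fun X Y f => exist (@P _ _) _ (Pm X Y f)) i' c').
exact: functor_congr.
Qed.

End WideSubcategory.

(* The maps satisfying P form a subcategory through which L factors, so the
   identity of the localisation factors through it as well. *)
Lemma localisation_ind (C : category) (M : map_class C) (CS : cat_struct C)
    (L : functor C (Category CS)) (P : map_class (Category CS)) :
    is_localisation M L ->
    (forall X, P X X (idmor X)) ->
    (forall X Y Z (g : mor Y Z) (f : mor X Y),
       P _ _ g -> P _ _ f -> P X Z (g \o f)) ->
    (forall X Y (f : mor X Y) (g : mor Y X), P X Y f ->
       g \o f = idmor X -> f \o g = idmor Y -> P Y X g) ->
    (forall X Y (f : mor X Y), P _ _ (fmap L f)) ->
  forall X Y (f : mor X Y), P X Y f.
Proof.
move=> [_ invL univL] P1 PM PV PL.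
have [L1 L1E] := wide_corestriction P1 PM PL; subst L.
have invL1 : inverts M L1.
  move=> X Y f /invL [g [gf fg]].
  have Pg := PV _ _ _ _ (PL _ _ f) gf fg.
  by exists (exist _ g Pg); split; apply: wide_hom_eq.
have [F' [F'E _]] := univL _ _ invL1.
have [F0 [_ uniqL]] := univL _ _ invL.
have inclF' : compF (wide_inclusion P1 PM) F' = idF (Category CS).
  rewrite -(uniqL (idF _) (compF_idl _)); apply/esym/uniqL.
  by rewrite -compF_assoc F'E.
have PF X Y (f : mor X Y) : P _ _ (fmap (compF (wide_inclusion P1 PM) F') f).
  exact: (proj2_sig (fmap F' f)).
by rewrite inclF' in PF.
Qed.

(** * Criteria for equivalences *)

Lemma equivalence_fully_faithful (C D : category) (F : functor C D) :
    (forall (X Y : C) (f g : mor X Y), fmap F f = fmap F g -> f = g) ->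
    (forall (X Y : C) (v : mor (F X) (F Y)), exists u, fmap F u = v) ->
    (forall N : D, exists X, isomorphic (F X) N) ->
  is_equivalence F.
Proof.
move=> faithF fullF surjF.
pose lift X Y v := sval (cid (fullF X Y v)).
have liftK X Y v : fmap F (lift X Y v) = v by rewrite /lift; case: cid.
pose K N := sval (cid (surjF N)).
have isoK N : isomorphic (F (K N)) N by rewrite /K; case: cid.
pose e N := sval (cid (isoK N)).
have e_iso N : is_iso (e N) by rewrite /e; case: cid.
pose e' N := sval (cid (e_iso N)).
have e'P N : e' N \o e N = idmor _ /\ e N \o e' N = idmor _.
  by rewrite /e'; case: cid.
have e'K N : e' N \o e N = idmor _ by case: (e'P N).
have eK N : e N \o e' N = idmor _ by case: (e'P N).
(* The quasi-inverse transports maps along the chosen isomorphisms [e]. Faithfulness of [F] reduces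
   its functor laws, and naturality on the side of [C], to identities in [D]. *)
pose m N N' (f : mor N N') : mor (K N) (K N') := lift _ _ (e' N' \o (f \o e N)).
have m1 N : m N N (idmor N) = idmor (K N).
  by apply: faithF; rewrite liftK comp1m e'K fmap1.
have mM N N' N'' (g : mor N' N'') (f : mor N N') :
    m _ _ (g \o f) = m _ _ g \o m _ _ f.
  apply: faithF; rewrite fmap_comp !liftK -!compmA; congr (_ \o (_ \o _)).
  by rewrite [e N' \o _]compmA eK comp1m.
pose F' := Functor m1 mM; exists F'; split; constructor.
  have homK (X : C) : lift _ _ (e' (F X)) \o lift (K (F X)) X (e (F X)) =
      idmor _ by apply: faithF; rewrite fmap_comp !liftK e'K fmap1.
  have invK (X : C) : lift (K (F X)) X (e (F X)) \o lift _ _ (e' (F X)) =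
      idmor _ by apply: faithF; rewrite fmap_comp !liftK eK fmap1.
  apply: (@NatIso _ _ (compF F' F) (idF C) _ _ homK invK) => X Y f.
  apply: faithF => /=.
  by rewrite !fmap_comp !liftK compmA eK comp1m.
apply: (@NatIso _ _ (compF F F') (idF D) _ _ e'K eK) => N N' f /=.
by rewrite liftK compmA eK comp1m.
Qed.

(** The objects [P] of the last hypothesis act as projective presentations. They replace a calculus
    of fractions: maps out of them are controlled by induction over the localisation. *)
Lemma localisation_equivalence (C D : category) (M : map_class C)
    (H : functor C D) (CS : cat_struct C) (L : functor C (Category CS)) :
    is_localisation M L ->
    (forall (X Y : C) (f : mor X Y), M X Y f <-> is_iso (fmap H f)) ->
    (forall (X Y : C) (f g : mor X Y),
       fmap H f = fmap H g -> fmap L f = fmap L g) ->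
    (forall N : D, exists P : C,
       (forall (Y : C) (v : mor (H P) (H Y)), exists u, fmap H u = v) /\
       isomorphic (H P) N) ->
  exists G, unique (fun G => compF G L = H) G /\ is_equivalence G.
Proof.
move=> locL MH HL presH; have [LE invL univL] := locL.
have [|G [GE Guniq]] := univL D H; first by move=> X Y f /MH.
exists G; split=> //; subst H.
(* [L] fixes objects only up to a propositional equality. Destructing [L] and substituting its
   object map makes [L X] convertible to [X], so that [CS]-morphisms and images under [L] can be
   composed. *)
have {}LE : fobj L = id by apply: funext.
case: L => l lm l1 lM /= in LE G locL MH HL presH invL univL Guniq *.
subst l; move: locL MH HL presH invL; set L := Functor l1 lM.
move=> locL MH HL presH invL.
(* Allowing every [u] out of [P], and not just an identity, makes the property of [f] stable under
   composition. *)
have strong X Y (f : @mor (Category CS) X Y) : forall P : C,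
    (forall (Y : C) (v : mor (G P) (G Y)), exists u : @mor C P Y,
       fmap G (fmap L u) = v) ->
    forall u : @mor C P X, exists w : @mor C P Y, f \o fmap L u = fmap L w.
  move: X Y f; apply: (localisation_ind locL).
  - by move=> X P fullP u; exists u; rewrite comp1m.
  - move=> X Y Z g f lg lf P fullP u; have [w fu] := lf P fullP u.
    have [w' gw] := lg P fullP w; exists w'.
    by rewrite -compmA fu gw.
  - move=> X Y f g lf gf fg P fullP u.
    (* For the inverse [g] of [f], lift the image under [G] of [g \o fmap L u] to [w]. Then
       [f \o fmap L w] is some [fmap L w'] with the same image under [G] as [fmap L u], hence equal
       to it, and [f] cancels. *)
    have [w Gw] := fullP _ (fmap G g \o fmap G (fmap L u)).
    have [w' fw] := lf P fullP w.
    exists w; have -> : fmap L u = fmap L w'.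
      apply: HL; change (fmap G (fmap L u) = fmap G (fmap L w')).
      by rewrite -fw fmap_comp Gw compmA -fmap_comp fg fmap1 comp1m.
    by rewrite -fw compmA gf comp1m.
  - by move=> X Y f P _ u; exists (f \o u); rewrite -(fmap_comp L).
(* Lift an isomorphism from [G P] to [G X] to a map [r] of [C]. Since [H] inverts [r], it lies in
   [M], so [L] inverts it too. *)
have resol X : exists (P : C) (r : @mor C P X),
    (forall (Y : C) (v : mor (G P) (G Y)), exists u : @mor C P Y,
       fmap G (fmap L u) = v) /\ is_iso (fmap L r).
  have [P [fullP [f f_iso]]] := presH (G X).
  have [r rE] := fullP _ f; exists P, r; split=> //.
  apply/invL/MH; change (is_iso (fmap G (fmap L r))).
  by rewrite rE.
apply: equivalence_fully_faithful.
(* Precomposing with the isomorphism [fmap L r] replaces source [X] by [P], both here and for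
   fullness. *)
- move=> X Y f g Gfg; have [P [r [fullP [s [_ rs]]]]] := resol X.
  have [u fr] := strong X Y f P fullP r; have [v gr] := strong X Y g P fullP r.
  have uv : fmap L u = fmap L v.
    apply: HL; change (fmap G (fmap L u) = fmap G (fmap L v)).
    by rewrite -fr -gr !fmap_comp Gfg.
  by rewrite -[f]compm1 -[g]compm1 -rs !compmA fr gr uv.
- move=> X Y v; have [P [r [fullP [s [_ rs]]]]] := resol X.
  have [u uE] := fullP Y (v \o fmap G (fmap L r)).
  exists (fmap L u \o s).
  by rewrite fmap_comp uE -compmA -fmap_comp rs fmap1 compm1.
- by move=> N; have [P [_ PN]] := presH N; exists P.
Qed.

(** * Bilinearity of composition and finite biproducts *)

Section LinearCategory.
Variables (k : fieldType) (C : linear_category k).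
Implicit Types X Y Z : C.

Lemma compDl X Y Z (g h : mor Y Z) (f : mor X Y) :
  (g + h : mor Y Z) \o f = (g \o f) + (h \o f).
Proof. by have := comp_linearl f 1 g h; rewrite !scale1r. Qed.

Lemma compDr X Y Z (g : mor Y Z) (f h : mor X Y) :
  g \o (f + h : mor X Y) = (g \o f) + (g \o h).
Proof. by have := comp_linearr g 1 f h; rewrite !scale1r. Qed.

Lemma comp0m X Y Z (f : mor X Y) : (0 : mor Y Z) \o f = 0.
Proof. by apply: (addrI ((0 : mor Y Z) \o f)); rewrite -compDl !addr0. Qed.

Lemma compm0 X Y Z (g : mor Y Z) : g \o (0 : mor X Y) = 0.
Proof. by apply: (addrI (g \o (0 : mor X Y))); rewrite -compDr !addr0. Qed.

Lemma compNl X Y Z (g : mor Y Z) (f : mor X Y) :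
  (- g : mor Y Z) \o f = - (g \o f).
Proof. by apply: (addrI (g \o f)); rewrite -compDl !subrr comp0m. Qed.

Lemma compNr X Y Z (g : mor Y Z) (f : mor X Y) :
  g \o (- f : mor X Y) = - (g \o f).
Proof. by apply: (addrI (g \o f)); rewrite -compDr !subrr compm0. Qed.

Lemma comp_suml X Y Z n (g : 'I_n -> mor Y Z) (f : mor X Y) :
  (\sum_i g i : mor Y Z) \o f = \sum_i (g i \o f).
Proof.
by apply: (big_morph (fun g : mor Y Z => g \o f));
  [move=> ? ?; apply: compDl | apply: comp0m].
Qed.

Lemma comp_sumr X Y Z n (g : mor Y Z) (f : 'I_n -> mor X Y) :
  g \o (\sum_i f i : mor X Y) = \sum_i (g \o f i).
Proof.
by apply: (big_morph (fun f : mor X Y => g \o f));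
  [move=> ? ?; apply: compDr | apply: compm0].
Qed.

Lemma zero_object_ex X : additive_category C -> exists Z : C, is_zero_object Z.
Proof.
move=> addC; have [Z [inj [prj [_ _]]]] := addC 0%N (fun=> X).
rewrite big_ord0 => id0; exists Z; split=> Y f.
  by rewrite -[f]comp1m -id0 comp0m.
by rewrite -[f]compm1 -id0 compm0.
Qed.

Lemma biproduct_ex (X Y : C) : additive_category C ->
  exists (Z : C) (i : mor X Z) (p : mor Z X) (j : mor Y Z) (q : mor Z Y),
  [/\ p \o i = idmor X, q \o j = idmor Y, q \o i = 0, p \o j = 0
    & (i \o p) + (j \o q) = idmor Z].
Proof.
move=> addC.
pose F (i : 'I_2) : C := if val i is 0%N then X else Y.
have [Z [inj [prj [diag off]]]] := addC 2 F.
rewrite !big_ord_recl big_ord0 addr0 => sum1.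
exists Z, (inj ord0), (prj ord0).
exists (inj (lift ord0 ord0)), (prj (lift ord0 ord0)).
split=> //; first exact: (diag ord0).
- exact: (diag (lift ord0 ord0)).
- exact: (off ord0 (lift ord0 ord0)).
- exact: (off (lift ord0 ord0) ord0).
Qed.

End LinearCategory.

(** * Exactness properties of triangles *)

Section Triangles.
Variables (k : fieldType) (C : triangulated_category k).
Implicit Types W X Y Z : C.
Local Notation S := (susp C).

Lemma susp0 X Y : fmap S (0 : mor X Y) = 0.
Proof.
by have := @susp_linear _ C X Y (-1) 0 0; rewrite scaler0 add0r scaleN1r addNr.
Qed.

(** Conjugating by the components of [e] recovers [f] from [fmap K (fmap F f)]. This serves for
    suspension and desuspension alike. *)
Lemma fmap_faithful_of_retraction (A B : category) (F : functor A B)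
    (K : functor B A) (e : nat_iso (compF K F) (idF A)) (X Y : A)
    (f g : mor X Y) :
  fmap F f = fmap F g -> f = g.
Proof.
move=> fg; have := ni_natural e f; have := ni_natural e g; rewrite /= fg => ->.
move=> /(congr1 (fun h => h \o ni_inv e X)).
by rewrite -!compmA (ni_invK e) !compm1.
Qed.

Lemma susp_faithful X Y (f g : mor X Y) : fmap S f = fmap S g -> f = g.
Proof. exact: (fmap_faithful_of_retraction (suspK C)). Qed.

Lemma susp_full X Y (g : mor (S X) (S Y)) : exists f, fmap S f = g.
Proof.
exists (ni_hom (suspK C) Y \o (fmap (desusp C) g \o ni_inv (suspK C) X)).
(* Desuspension is faithful, so the equality may be tested after applying it; there it is naturality
   of [suspK] at the candidate. *)
apply: (fmap_faithful_of_retraction (desuspK C)).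
set f := (_ \o _).
have := ni_natural (suspK C) f.
rewrite {2}/f /= -!compmA (ni_homK (suspK C)) compm1.
move=> /(congr1 (fun h => ni_inv (suspK C) Y \o h)).
by rewrite !compmA (ni_homK (suspK C)) !comp1m.
Qed.

Lemma susp_zero_object Z : is_zero_object Z -> is_zero_object (S Z).
Proof.
case=> Z0 _; have id0 : idmor (S Z) = 0.
  by rewrite -fmap1 (Z0 _ (idmor Z)) susp0.
by split=> Y f; [rewrite -[f]comp1m id0 comp0m | rewrite -[f]compm1 id0 compm0].
Qed.

Section OneTriangle.
Variables (X Y Z : C) (u : mor X Y) (v : mor Y Z) (w : mor Z (S X)).
Hypothesis uvw : dist u v w.
Let ax := tri_axioms C.

Lemma dist_rot : dist v w (- fmap S u).
Proof. exact: (proj1 (tr2 ax u v w)). Qed.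

(** The triangle on [idmor X] maps to the given one by [idmor X] and [u], so [v \o u] factors
    through a zero object. *)
Lemma dist_comp0 : v \o u = 0.
Proof.
have [O O0] := zero_object_ex X (@tri_additive _ C).
have [|h [<- _]] := tr3 ax (f := idmor X) (g := u) (tr1_id ax X O0) uvw.
  by [].
by rewrite compm0.
Qed.

(** [tr3] supplies the third map of a morphism of triangles, so both the trivial triangle on [W] and
    the given one are rotated first. The lift then appears suspended, with the two signs
    cancelling. *)
Lemma dist_lift W (f : mor W Y) : v \o f = 0 -> exists g, u \o g = f.
Proof.
move=> vf0; have [O O0] := zero_object_ex X (@tri_additive _ C).
have dW := proj1 (tr2 ax _ _ _) (tr1_id ax W O0).
have [|h [_ hE]] := tr3 ax (f := f) (g := (0 : mor O Z)) dW dist_rot.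
  by rewrite compm0 vf0.
have [g gh] := susp_full h; exists g; apply: susp_faithful.
move: hE; rewrite fmap1 compNr compm1 compNl => /oppr_inj ->.
by rewrite fmap_comp gh.
Qed.

(** Compare with the triangle [O -> W -> W -> S O], whose middle map is the identity; the map on
    third terms is the extension. *)
Lemma dist_colift W (f : mor Y W) : f \o u = 0 -> exists g, g \o v = f.
Proof.
move=> fu0; have [O O0] := zero_object_ex X (@tri_additive _ C).
have dW : dist (0 : mor O W) (idmor W) (0 : mor W (S O)).
  apply/(tr2 ax); rewrite susp0 oppr0.
  exact: tr1_id (susp_zero_object O0).
have [|h [hE _]] := tr3 ax (f := (0 : mor X O)) (g := f) uvw dW.
  by rewrite fu0 comp0m.
by exists h; rewrite hE comp1m.
Qed.

End OneTriangle.

(** Rotate a cone triangle of [f] backwards: [h] desuspends minus the connecting map, and this sign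
    cancels the one in [tr2]. The isomorphism [desuspK] identifies the third objects. *)
Lemma dist_desusp_completion X Y (f : mor X Y) :
  exists (Z : C) (h : mor (desusp C Z) X) (g : mor Y Z), dist_desusp h f g.
Proof.
have [Z [g [w fgw]]] := tr1_cone (tri_axioms C) f.
have [h hE] := susp_full (- (w \o ni_hom (desuspK C) Z)).
exists Z, h, g; apply/(tr2 (tri_axioms C)); rewrite hE opprK.
pose e := desuspK C.
apply: (tr1_iso (tri_axioms C) (f := idmor X) (g := idmor Y)
  (h := ni_inv e Z) fgw).
- by exists (idmor X); rewrite comp1m.
- by exists (idmor Y); rewrite comp1m.
- by exists (ni_hom e Z); split; [apply: (ni_invK e) | apply: (ni_homK e)].
- by rewrite comp1m compm1.
- by rewrite compm1.
- by rewrite fmap1 comp1m -compmA (ni_invK e) compm1.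
Qed.

End Triangles.

(** * Finite-dimensional spaces and modules *)

(** Choose finitely many vectors satisfying [P] whose span has maximal dimension: adding another
    vector satisfying [P] cannot enlarge it. Spans are taken in coordinates, among row vectors. *)
Lemma fd_subspace_span (k : fieldType) (V : lmodType k) (P : V -> Prop) :
    finite_dimensional V ->
  exists (n : nat) (e : 'I_n -> V), (forall i, P (e i)) /\
    (forall v, P v -> exists c : 'I_n -> k, v = \sum_i c i *: e i).
Proof.
case=> m [[v2r v2r_lin [r2v v2rK r2vK]]].
pose Q d := `[< exists2 s : seq 'rV[k]_m,
  (forall x, x \in s -> P (r2v x)) & \dim <<s>> = d >].
have exQ : exists d, Q d.
  by exists (\dim <<[::] : seq 'rV[k]_m>>); apply/asboolP; exists [::].
have boundQ d : Q d -> (d <= \dim {: 'rV[k]_m})%N.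
  by move=> /asboolP [s _ <-]; apply/dimvS/subvf.
case: (ex_maxnP exQ boundQ) => d /asboolP [s sP sd] dmax.
exists (size s), (fun i => r2v s`_i); split=> [i|v Pv]; first exact/sP/mem_nth.
have vs : v2r v \in <<s>>%VS.
  have /dmax : Q (\dim <<v2r v :: s>>).
    apply/asboolP; exists (v2r v :: s) => // x.
    by rewrite inE => /predU1P [->|/sP //]; rewrite v2rK.
  rewrite -sd => le_dim.
  have sub : (<<s>> <= <<v2r v :: s>>)%VS by rewrite span_cons addvSr.
  have /eqP -> : (<<s>> == <<v2r v :: s>>)%VS.
    by rewrite eqEdim sub.
  by apply: memv_span; rewrite inE eqxx.
exists (fun i => coord (in_tuple s) i (v2r v)).
apply: (can_inj v2rK); rewrite {1}(coord_span (X := in_tuple s) vs).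
rewrite (big_morph v2r (id1 := 0) (op1 := +%R)).
- apply: eq_bigr => i _.
  by rewrite (scalable_linear v2r_lin) r2vK.
- by move=> x y; have := v2r_lin 1 x y; rewrite !scale1r.
- pose v2r_mixin := GRing.isLinear.Build _ _ _ _ v2r v2r_lin.
  exact: (raddf0 (HB.pack v2r v2r_mixin : {linear V -> _})).
Qed.

Lemma fdmod_isoP (k : fieldType) (A : pzRingType) (iota : {rmorphism k -> A})
    (M N : fd_module iota) (f : {linear M -> N}) :
  @is_iso (fdmod iota) M N f <->
  (forall x, f x = 0 -> x = 0) /\ (forall y, exists x, f x = y).
Proof.
split=> [[g [gf fg]]|[f_inj f_surj]].
  have fK x : (g : {linear N -> M}) (f x) = x.
    exact: (congr1 (fun h : {linear fd_sort M -> fd_sort M} => h x) gf).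
  have gK y : f ((g : {linear N -> M}) y) = y.
    exact: (congr1 (fun h : {linear fd_sort N -> fd_sort N} => h y) fg).
  split=> [x fx0|y]; last by exists ((g : {linear N -> M}) y).
  by rewrite -[x]fK fx0 raddf0.
pose g y := sval (cid (f_surj y)).
have gK y : f (g y) = y by rewrite /g; case: cid.
have fK x : g (f x) = x.
  apply/eqP; rewrite -subr_eq0; apply/eqP/f_inj.
  by rewrite (raddfB f) /= gK subrr.
have g_lin : linear g.
  by move=> a x y; apply: (can_inj fK); rewrite gK (linearP f) /= !gK.
pose gL : {linear N -> M} := HB.pack g (GRing.isLinear.Build _ _ _ _ g g_lin).
by exists gL; split; apply: eq_linear => x /=.
Qed.

(** * Powers of T and free modules *)

Section Powers.
Variables (k : fieldType) (C : linear_category k) (T : C).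
Implicit Types X Y : C.

Definition is_power (S : C) := exists n, is_direct_sum (fun _ : 'I_n => T) S.

Lemma linear_act X (M : lmodType (End_ring T)^c)
    (f : {linear Hom_module T X -> M}) (a : mor T X) (b : mor T T) :
  f (a \o b : Hom_module T X) =
  (b : (End_ring T)^c) *: f (a : Hom_module T X).
Proof. exact: linearZ. Qed.

Lemma power_ext (S X : C) (m : mor S X) : is_power S ->
  (forall a : mor T S, m \o a = 0) -> m = 0.
Proof.
move=> [n [inj [prj [_ _ sum1]]]] m0; rewrite -[m]compm1 -sum1 comp_sumr.
by apply: big1 => i _; rewrite compmA m0 comp0m.
Qed.

(** Hom(T, S) is a free module on the injections, so [f] is determined by its values there, and
    these values are the components of [m]. *)
Lemma power_yoneda (S X : C) (f : {linear Hom_module T S -> Hom_module T X}) :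
  is_power S -> exists m : mor S X, forall a, m \o a = f a.
Proof.
move=> [n [inj [prj [_ _ sum1]]]].
exists (\sum_i ((f (inj i) : mor T X) \o prj i)) => a.
rewrite comp_suml -[a in RHS]comp1m -sum1 comp_suml.
rewrite [RHS](raddf_sum f).
by apply: eq_bigr => i _; rewrite -!compmA; apply: esym (linear_act f _ _).
Qed.

Lemma power_copair (n : nat) (S X : C) (e : 'I_n -> mor T X)
    (inj : 'I_n -> mor T S) (prj : 'I_n -> mor S T) (i : 'I_n) :
    (forall i, prj i \o inj i = idmor T) ->
    (forall i j, i != j -> prj j \o inj i = 0) ->
  (\sum_j (e j \o prj j) : mor S X) \o inj i = e i.
Proof.
move=> diag off; rewrite comp_suml (bigD1 i) //= -compmA.
rewrite diag compm1 big1 ?addr0 //.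
by move=> j ji; rewrite -compmA off 1?eq_sym // compm0.
Qed.

(** Finitely many elements of [P] span it already over [k]; they are the components of [p]. The
    closure hypotheses keep the image of [p] inside [P]. *)
Lemma submodule_image_of_power X (P : mor T X -> Prop) :
    additive_category C -> finite_dimensional (mor T X) -> P 0 ->
    (forall a b : mor T X, P a -> P b -> P (a + b : mor T X)) ->
    (forall (a : mor T X) (c : mor T T), P a -> P (a \o c)) ->
  exists (S : C) (p : mor S X),
    is_power S /\ forall a, P a <-> exists b, p \o b = a.
Proof.
move=> addC fin P0 PD PM.
have [n [e [Pe span]]] := @fd_subspace_span k (mor T X) P fin.
have [S [inj [prj [diag off sum1]]]] := addC n (fun=> T).
exists S, (\sum_j ((e j : mor T X) \o prj j)).
split; first by exists n, inj, prj.
move=> a; split=> [/span [c ->]|[b <-]].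
  exists (\sum_i (c i *: inj i : mor T S)).
  rewrite comp_sumr; apply: eq_bigr => i _.
  by rewrite (scalable_linear (comp_linearr _)) power_copair.
rewrite comp_suml; elim/big_ind: _ => // i _.
by rewrite -compmA; apply: PM.
Qed.

End Powers.

(** * The functor Hom(T, -) for a rigid object T *)

Section RigidObject.
Variables (k : fieldType) (C : triangulated_category k) (hfin : hom_finite C).
Variables (T : C) (rigidT : rigid T).
Implicit Types X Y U : C.

(** Rigidity enters here: each component of [f] is a map from T to its suspension. *)
Lemma power_susp_orthogonal (S : C) : is_power T S ->
  hom_orthogonal T (susp C S).
Proof.
move=> [n [inj [prj [_ _ sum1]]]] f.
rewrite -[f]comp1m -fmap1 -sum1.
rewrite (big_morph (fun g : mor S S => fmap (susp C) g)
  (id1 := 0) (op1 := +%R)).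
- rewrite comp_suml; apply: big1 => i _.
  rewrite fmap_comp -compmA.
  by rewrite [X in _ \o X](rigidT (fmap (susp C) (prj i) \o f)) compm0.
- by move=> g h; have := @susp_linear _ C S S 1 g h; rewrite !scale1r.
- exact: susp0.
Qed.

Lemma power_approximation X : exists (S : C) (p : mor S X),
  is_power T S /\ forall a : mor T X, exists b, p \o b = a.
Proof.
have [//|//|//|S [p [powS imp]]] := @submodule_image_of_power k C T X
  (fun=> True) (@tri_additive _ C) (hfin T X).
by exists S, p; split=> // a; apply/imp.
Qed.

(* If f kills all maps from T, it factors through the cone of an approximation
   of X by a power of T, and this cone lies in X_T. *)
Lemma factors_through_orthogonal X Y (f : mor X Y) :
  factors_through (hom_orthogonal T) f <-> forall a : mor T X, f \o a = 0.
Proof.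
split=> [[U [U0 [a [b ->]]]] c|f0].
  by rewrite -compmA (U0 (a \o c)) compm0.
have [S [p [powS surjp]]] := power_approximation X.
have [U [v [w pvw]]] := tr1_cone (tri_axioms C) p.
have [|g gv] := dist_colift pvw (f := f).
  by apply: (power_ext powS) => a; rewrite -compmA f0.
exists U; split; last by exists v, g.
move=> a; have [|b <-] := dist_lift (dist_rot pvw) (f := a).
  exact: (power_susp_orthogonal powS).
have [c <-] := surjp b.
by rewrite compmA (dist_comp0 pvw) comp0m.
Qed.

(** By exactness of Hom(T, -) on the triangle, [f] induces an injection exactly when [h] induces
    zero and a surjection exactly when [g] does. Inducing zero means factoring through X_T. *)
Lemma S_tildeP X Y (f : mor X Y) :
  S_tilde T f <-> is_iso (fmap (HomT T hfin) f).
Proof.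
have isoE := @fdmod_isoP _ _ _ (HomT_obj T hfin X) (HomT_obj T hfin Y)
  (HomT_map T hfin f).
apply: (iff_trans _ (iff_sym isoE)).
split=> [[Z [h [g []]]]|].
  move=> hfg /factors_through_orthogonal g0 /factors_through_orthogonal h0.
  split=> [x fx0|y].
    by have [x' <-] := dist_lift hfg fx0; apply: h0.
  have [|x <-] := dist_lift (dist_rot hfg) (f := y); last by exists x.
  by rewrite -compmA (g0 y) compm0.
move=> [f_inj f_surj]; have [Z [h [g hfg]]] := dist_desusp_completion f.
exists Z, h, g; split=> //; apply/factors_through_orthogonal => a.
  have [b <-] := f_surj a.
  have gf0 := dist_comp0 (dist_rot hfg).
  have {}gf0 : g \o f = 0.
    rewrite -[g]comp1m -(ni_invK (desuspK C)).
    by rewrite -!compmA [_ \o (g \o f)]compmA gf0 compm0.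
  by rewrite [LHS]compmA gf0 comp0m.
by apply: f_inj; rewrite [LHS]compmA (dist_comp0 hfg) comp0m.
Qed.

Lemma presentation (M : mod_End_op T) : exists P : C,
  (forall Y (f : mor (HomT T hfin P) (HomT T hfin Y)),
     exists c, fmap (HomT T hfin) c = f) /\
  isomorphic (HomT T hfin P) M.
Proof.
have [n [e [_ span]]] := fd_subspace_span (fun=> True) (fd_finite M).
have [T0 [inj [prj [diag off sum1]]]] := @tri_additive _ C n (fun=> T).
have pow0 : is_power T T0 by exists n, inj, prj.
(* The map from the free module Hom(T, T0) to [M] sending the basis element [inj i] to [e i]. *)
pose pi (a : Hom_module T T0) : fd_sort M :=
  \sum_i (prj i \o (a : mor T T0) : (End_ring T)^c) *: (e i : fd_sort M).
have pi_lin : linear pi.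
  move=> b a a'; rewrite /pi scaler_sumr -big_split; apply: eq_bigr => i _ /=.
  rewrite scalerA -scalerDl; congr (_ *: _).
  by rewrite [LHS]compDr; congr (_ + _); rewrite [LHS]compmA.
pose piL : {linear Hom_module T T0 -> fd_sort M} :=
  HB.pack pi (GRing.isLinear.Build _ _ _ _ pi pi_lin).
have pi_surj m : exists a, pi a = m.
  have [c mE] := span m I.
  (* Scalars of [k] act on [M] through [c *: idmor T], which is what [prj j] reads off from this
     element. *)
  exists (\sum_i (c i *: inj i : mor T T0)).
  have prjE j : prj j \o (\sum_i (c i *: inj i : mor T T0)) = c j *: idmor T.
    rewrite comp_sumr (bigD1 j) //= big1 => [|i ij].
      by rewrite (scalable_linear (comp_linearr (prj j))) diag addr0.
    rewrite (scalable_linear (comp_linearr (prj j))) off //; exact: scaler0.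
  by rewrite mE; apply: eq_bigr => i _; rewrite [in LHS]prjE.
(* The kernel of [pi] is the image of a power [T1], which gives a free presentation of [M]. *)
have [|||T1 [u [pow1 kerE]]] := @submodule_image_of_power k C T T0
  (fun a => piL a = 0) (@tri_additive _ C) (hfin T T0).
- exact: raddf0.
- by move=> a b a0 b0; rewrite [LHS](raddfD piL a b) [X in X + _]a0
    [X in _ + X]b0 addr0.
- by move=> a c a0; rewrite [LHS](linear_act piL) [X in _ *: X]a0 scaler0.
have [P [v [w uvw]]] := tr1_cone (tri_axioms C) u.
(* The obstruction to lifting lies in Hom(T, S T1), which vanishes. Hence Hom(T, P) is the cokernel
   of the map induced by [u]. *)
have v_surj (a : mor T P) : exists b, v \o b = a.
  by apply: (dist_lift (dist_rot uvw)); apply: (power_susp_orthogonal pow1).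
have v_ker (a : mor T T0) : v \o a = 0 <-> pi a = 0.
  split=> [/(dist_lift uvw) ? | /kerE [b <-]]; first exact/kerE.
  by rewrite compmA (dist_comp0 uvw) comp0m.
exists P; split.
  move=> Y f; pose fL : {linear Hom_module T P -> Hom_module T Y} := f.
  (* Pulled back to [T0], the linear map comes from some [m]; as [m \o u] vanishes on maps from T,
     [m] extends over the cone. *)
  pose g : {linear Hom_module T T0 -> Hom_module T Y} :=
    (fL \o @Hom_map k C T T0 P v)%FUN.
  have [m mE] := power_yoneda g pow0.
  have [|c cE] := dist_colift uvw (f := m).
    apply: (power_ext pow1) => a.
    rewrite -compmA mE /= /Hom_map compmA (dist_comp0 uvw) comp0m.
    exact: raddf0.
  exists c; apply: eq_linear => a; have [b <-] := v_surj a.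
  by rewrite [LHS]compmA cE; apply: mE.
pose s a := sval (cid (v_surj a)).
have sK a : v \o s a = a by rewrite /s; case: cid.
(* The isomorphism induced by [pi] on the cokernel: two lifts along [v] differ by an element of the
   kernel of [pi], so their choice is immaterial. *)
pose psi (a : Hom_module T P) := pi (s a).
have psiE b : psi (v \o b) = pi b.
  apply/eqP; rewrite -subr_eq0; apply/eqP.
  rewrite -[LHS](raddfB piL); apply/v_ker.
  by rewrite [LHS]compDr [X in _ + X]compNr sK subrr.
have psi_lin : linear psi.
  move=> b a a'; rewrite -[RHS](linearP piL) -[RHS]psiE; congr psi.
  rewrite [RHS]compDr; congr (_ + _); last by rewrite [RHS]sK.
  by rewrite [RHS]compmA sK.
pose psiL : {linear Hom_module T P -> fd_sort M} :=
  HB.pack psi (GRing.isLinear.Build _ _ _ _ psi psi_lin).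
exists psiL; apply/fdmod_isoP; split=> [a|m].
  by move=> /v_ker; rewrite sK.
have [a <-] := pi_surj m; exists (v \o a); exact: psiE.
Qed.

(* With g - f = b o a factoring through U in X_T, the maps (1, 0) and (1, b)
   from X + U to X are inverted, being so by Hom(T, -), and have the common
   section (1, 0)^t; hence their images under L agree, and f and g are their
   composites with (f, a). *)
Lemma localisation_congr (CS : cat_struct C) (L : functor C (Category CS)) :
  inverts (S_tilde T) L -> forall X Y (f g : mor X Y),
  fmap (HomT T hfin) f = fmap (HomT T hfin) g -> fmap L f = fmap L g.
Proof.
move=> invL X Y f g fg.
have HfgE (a : mor T X) : f \o a = g \o a.
  exact: (congr1 (fun h : {linear Hom_module T X -> Hom_module T Y} => h a) fg).
have [U [U0 [a [b gf]]]] : factors_through (hom_orthogonal T) (g - f : mor X Y).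
  apply/factors_through_orthogonal => c.
  by rewrite compDl compNl HfgE subrr.
have [Z [i [p [j [q [pi qj qi pj sum1]]]]]] :=
  biproduct_ex Y U (@tri_additive _ C).
have ip (c : mor T Z) : (i \o p) \o c = c.
  rewrite -[RHS]comp1m -sum1 compDl -[X in _ + X]compmA [q \o c]U0.
  by rewrite compm0 addr0.
have p_iso : is_iso (fmap L p).
  apply/invL/S_tildeP.
  exists (fmap (HomT T hfin) i); rewrite -!fmap_comp pi fmap1; split=> //.
  apply: eq_linear => c; exact: (ip c).
have [s [sp ps]] := p_iso.
have iE : fmap L i = s.
  by rewrite -[LHS]comp1m -sp -compmA -fmap_comp pi fmap1 compm1.
pose r : mor Z Y := p + (b \o q).
have rE : fmap L r = fmap L p.
  rewrite -[LHS]compm1 -sp -iE compmA -fmap_comp.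
  by rewrite compDl pi -compmA qi compm0 addr0 fmap1 comp1m.
pose t : mor X Z := (i \o f) + (j \o a).
have pt : p \o t = f by rewrite compDr !compmA pi pj comp0m addr0 comp1m.
have rt : r \o t = g.
  rewrite compDl pt -compmA compDr !compmA qi qj comp0m comp1m add0r -gf.
  by rewrite addrC subrK.
by rewrite -pt -rt !fmap_comp rE.
Qed.

End RigidObject.

Theorem theorem4p4 (k : fieldType) (C : triangulated_category k)
    (small : skeletally_small C) (hfin : hom_finite C) (KS : krull_schmidt C)
    (T : C) (rigidT : rigid T)
    (CS : cat_struct C) (L : functor C (Category CS))
    (locL : is_localisation (S_tilde T) L) :
  exists G : functor (Category CS) (mod_End_op T),
    unique (fun G => compF G L = HomT T hfin) G /\ is_equivalence G.
Proof.
have [_ invL _] := locL.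
apply: (localisation_equivalence locL).
- by move=> X Y f; apply: S_tildeP.
- exact: localisation_congr.
- exact: presentation.
Qed.
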